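(* Let $\phi\in\mathcal A$, let $K$ be a compact subset of $\mathbb R^3$ and let $\epsilon>0$. Suppose there is a constant $L$ such that for all $a,a'\in\mathbb R$ and all $x,y\in\mathbb R$, $$\left|\frac{\partial}{\partial x}f_{a'}(x,y)-\frac{\partial}{\partial x}f_a(x,y)\right|\le L\cdot|f_{a'}(x,y)-f_a(x,y)|\,\log\frac{1}{|f_{a'}(x,y)-f_a(x,y)|},$$ $$\left|\frac{\partial}{\partial y}f_{a'}(x,y)-\frac{\partial}{\partial y}f_a(x,y)\right|\le L\cdot|f_{a'}(x,y)-f_a(x,y)|\,\log\frac{1}{|f_{a'}(x,y)-f_a(x,y)|}.$$ Then there exists a function $\psi\in\mathcal C^1(\mathbb R^3)$ such that for every point $(x,y,z)=(x,y,f_a(x,y))\in K$, $$|\psi(x,y,z)-\phi(x,y,z)|<\epsilon,$$ $$\left|\frac{\partial}{\partial x}[\psi(x,y,f_a(x,y))]-\frac{\partial}{\partial x}[\phi(x,y,f_a(x,y))]\right|<\epsilon,$$ $$\left|\frac{\partial}{\partial y}[\psi(x,y,f_a(x,y))]-\frac{\partial}{\partial y}[\phi(x,y,f_a(x,y))]\right|<\epsilon.$$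
   Context: For every $a\in\mathbb R$ a $\mathcal C^1$ function $f_a:\mathbb R^2\to\mathbb R$ is given, with graph the surface $\Gamma_a=\{(x,y,f_a(x,y)):(x,y)\in\mathbb R^2\}$. The surfaces $\Gamma_a$ are pairwise disjoint and there is a surface through every point of $\mathbb R^3$. $\mathcal A$ is the class of functions $\phi\in\mathcal C(\mathbb R^3)$ (continuous, real-valued) such that for every $a$ the restriction $\phi|_{\Gamma_a}$ is $\mathcal C^1$ (i.e. $(x,y)\mapsto\phi(x,y,f_a(x,y))$ is $\mathcal C^1$) and such that the functions $\Phi(x,y,z):=\frac{\partial}{\partial x}[\phi(x,y,f_a(x,y))]$ and $\Psi(x,y,z):=\frac{\partial}{\partial y}[\phi(x,y,f_a(x,y))]$, where $z=f_a(x,y)$, are continuous on $\mathbb R^3$. *)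

(* Defs.v *)
From HB Require Import structures.
From mathcomp Require Import all_boot all_order all_algebra.
From mathcomp Require Import all_classical all_reals all_analysis.

Set Implicit Arguments.
Unset Strict Implicit.
Unset Printing Implicit Defensive.

Import Order.TTheory GRing.Theory Num.Theory.
Import numFieldNormedType.Exports.
Local Open Scope classical_set_scope.
Local Open Scope ring_scope.

(* The plane is R * R and space is R * R * R = (R * R) * R, with their product
   topologies. *)

Definition partial_x (R : realType) (g : R * R -> R) (p : R * R) : R :=
  derive1 (fun t : R => g (t, p.2)) p.1.

Definition partial_y (R : realType) (g : R * R -> R) (p : R * R) : R :=
  derive1 (fun t : R => g (p.1, t)) p.2.

(* derive1 is a total operator, hence the separate derivability conditions in the
   two definitions of C^1 below. *)
Definition C1_plane (R : realType) (g : R * R -> R) : Prop :=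
  [/\ forall x y : R, derivable (fun t : R => g (t, y)) x 1,
      forall x y : R, derivable (fun t : R => g (x, t)) y 1,
      continuous (partial_x g) & continuous (partial_y g)].

Definition C1_space (R : realType) (g : R * R * R -> R) : Prop :=
  [/\ forall x y z : R,
        [/\ derivable (fun t : R => g (t, y, z)) x 1,
            derivable (fun t : R => g (x, t, z)) y 1 &
            derivable (fun t : R => g (x, y, t)) z 1],
      continuous (fun q : R * R * R =>
        derive1 (fun t : R => g (t, q.1.2, q.2)) q.1.1),
      continuous (fun q : R * R * R =>
        derive1 (fun t : R => g (q.1.1, t, q.2)) q.1.2) &
      continuous (fun q : R * R * R =>
        derive1 (fun t : R => g (q.1.1, q.1.2, t)) q.2)].

Definition surface (R : realType) (g : R * R -> R) : set (R * R * R) :=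
  [set q | q.2 = g q.1].

Definition C1_foliation (R : realType) (f : R -> R * R -> R) : Prop :=
  [/\ forall a : R, C1_plane (f a),
      trivIset setT (fun a : R => surface (f a)) &
      \bigcup_(a in setT) surface (f a) = setT].

Definition on_surface (R : realType) (g : R * R -> R) (phi : R * R * R -> R)
    (p : R * R) : R :=
  phi (p, g p).

(* The surfaces of a foliation partition space, so the values prescribed on
   them determine Phi and Psi uniquely. *)
Definition partially_C1 (R : realType) (f : R -> R * R -> R)
    (phi : R * R * R -> R) : Prop :=
  [/\ continuous phi,
      forall a : R, C1_plane (on_surface (f a) phi),
      exists Phi : R * R * R -> R, continuous Phi /\
        forall (a : R) (p : R * R),
          Phi (p, f a p) = partial_x (on_surface (f a) phi) p &
      exists Psi : R * R * R -> R, continuous Psi /\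
        forall (a : R) (p : R * R),
          Psi (p, f a p) = partial_y (on_surface (f a) phi) p].

(* The modulus of continuity d * log (1 / d) is positive only for 0 < d < 1,
   so the bound is required only of surfaces at vertical distance d < 1 over
   the given point.  Without this restriction the right-hand side would be
   negative for d > 1 and L > 0; since the surfaces of a foliation fill space,
   only L = 0, i.e. vertical translates of a single surface, would be allowed.
   The unrestricted bound implies this one.  For d = 0 the right-hand side
   is 0. *)
Definition log_lipschitz (R : realType) (f g : R -> R * R -> R) (L : R) : Prop :=
  forall (a a' : R) (p : R * R),
    `|f a' p - f a p| < 1 ->
    `|g a' p - g a p| <= L * `|f a' p - f a p| * ln (1 / `|f a' p - f a p|).

(* Main.v *)
Require Import Defs.
From HB Require Import structures.
From mathcomp Require Import all_boot all_order all_algebra.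
From mathcomp Require Import all_classical all_reals all_analysis.
From mathcomp Require Import ring lra.

Set Implicit Arguments.
Unset Strict Implicit.
Unset Printing Implicit Defensive.

Import Order.TTheory GRing.Theory Num.Theory.
Import numFieldNormedType.Exports.
Local Open Scope classical_set_scope.
Local Open Scope ring_scope.

(* Label the leaves by their height over the origin; they are then ordered over
   every point of the plane.  By compactness finitely many leaves
   [G 0 < ... < G n] suffice for every point of [K] to lie between two
   consecutive ones whose vertical gap is so small that [phi], [Phi] and [Psi]
   oscillate by less than [e] across it.  Let [m] be a lower bound of the gaps
   over [K].  Between two leaves interpolate by
     psi (p, z) = D i p + (1 - h (z - G i p)) * (D (i+1) p - D i p),
   where [D i] is [phi] on the i-th leaf and [h] is a C^1 cutoff falling from 1
   at [0] to 0 at [m].  Along a leaf the derivative of [psi] contains, besides a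
   convex combination of values of [Phi], the error
     h' (s) * (d F - d (G i)) * (D (i+1) - D i),  with s = F - G i,
   and |d F - d (G i)| <= L s ln (1/s).  Since [ds / (s ln (1/s))] has infinite
   integral at [0] (Osgood), [h] can be chosen with |h' (s)| s ln (1/s) <= 2
   whatever [m] is, so the error is at most 2 |L| times the oscillation. *)

(** * The squared positive part and a piecewise quadratic step *)

Lemma is_derive1_continuous (R : realType) (f df : R -> R) (x : R) :
  is_derive x 1 f (df x) -> {for x, continuous f}.
Proof.
by move=> [fx _]; apply/differentiable_continuous/derivable1_diffP.
Qed.

Lemma continuous_max0 (R : realType) : continuous (fun v : R => Num.max v 0).
Proof.
move=> x; apply: (@continuous_max R R id (fun=> 0)); first exact: cvg_id.
exact: cvg_cst.
Qed.

Lemma is_derive_max0_sqr (R : realType) (v : R) :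
  is_derive v 1 (fun v : R => Num.max v 0 ^+ 2) (2 * Num.max v 0).
Proof.
have [v0|v0|->] := ltgtP v 0.
- apply: (@near_eq_is_derive _ _ _ (cst 0)).
    near=> w => /=; rewrite max_r ?expr0n//; apply: ltW.
    by near: w; exact: lt_nbhsl.
  by rewrite mulr0; exact: is_derive_cst.
- apply: (@near_eq_is_derive R R^o R^o (fun w : R => w ^+ 2)).
    near=> w; rewrite max_l//; apply: ltW.
    by near: w; exact: lt_nbhsr.
  have -> : (fun w : R => w ^+ 2) = (@id R) ^+ 2 by [].
  apply: is_derive_eq.
  by rewrite /= expr1 /GRing.scale /= mulr1 mulr_natl.
(* At the kink the difference quotient at [h] is exactly [Num.max h 0], which tends to 0. *)
- have H : (fun h : R => h^-1 *: (Num.max (h *: (1 : R) + 0) 0 ^+ 2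
             - Num.max 0 0 ^+ 2)) @ 0^' --> (0 : R).
    apply: (@cvg_trans _ ((fun h : R => Num.max h 0) @ 0^')).
      apply: near_eq_cvg; near=> h.
      have h0 : h != 0 by near: h; exact: nbhs_dnbhs_neq.
      rewrite /GRing.scale /= mulr1 addr0 maxxx expr0n subr0.
      have [hn|hp] := leP h 0; first by rewrite expr0n mulr0.
      by rewrite expr2 mulrA mulVf// mul1r.
    apply: cvg_within_filter.
    by have := @continuous_max0 R 0; rewrite /continuous_at maxxx.
  apply: DeriveDef; first by apply: cvgP H.
  by rewrite mulr0; apply/cvg_lim.
Unshelve. all: by end_near.
Qed.

(** This is 2 v^2 on [0, 1/2] and 1 - 2 (1 - v)^2 on [1/2, 1], constant outside. As a combination of
    squared positive parts it is differentiated by linearity, without gluing. *)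
Definition smooth_step (R : realType) (v : R) : R :=
  2 * (Num.max v 0 ^+ 2 - 2 * Num.max (v - 2^-1) 0 ^+ 2 + Num.max (v - 1) 0 ^+ 2).

(** The derivative of [smooth_step]: the hat function on [0, 1] with peak 2 at 1/2. *)
Definition tent (R : realType) (v : R) : R :=
  4 * (Num.max v 0 - 2 * Num.max (v - 2^-1) 0 + Num.max (v - 1) 0).

Section SmoothStep.
Variable R : realType.
Implicit Type v : R.

Lemma is_derive_smooth_step v : is_derive v 1 (@smooth_step R) (tent v).
Proof.
have D (c : R) : is_derive v 1 (fun v => Num.max (v - c) 0 ^+ 2)
    (2 * Num.max (v - c) 0).
  have d1 : is_derive v 1 (fun v => v - c) 1.
    rewrite (_ : (fun v => v - c) = (@id R) - cst c)//.
    by apply: is_derive_eq; rewrite subr0.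
  rewrite -[2 * _]mulr1.
  exact: (@is_derive1_comp _ (fun v => Num.max v 0 ^+ 2) (fun v => v - c)
    v _ _ (is_derive_max0_sqr _) d1).
have D0 := D 0; rewrite !subr0 in D0.
rewrite (_ : @smooth_step R = 2 *: ((fun v => Num.max (v - 0) 0 ^+ 2)
   - 2 *: (fun v => Num.max (v - 2^-1) 0 ^+ 2)
   + (fun v => Num.max (v - 1) 0 ^+ 2))); last first.
  by apply/funext => w; rewrite /smooth_step !fctE /= subr0.
have := D 0; have := D 2^-1; have := D 1 => d1 d2 d3.
apply: is_derive_eq.
rewrite /tent /GRing.scale /= subr0; ring.
Qed.

Lemma continuous_tent : continuous (@tent R).
Proof.
have C (c : R) : continuous (fun v => Num.max (v - c) 0).
  move=> w; apply: (@continuous_comp R R R (fun v => v - c) (fun v => Num.max v 0)).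
    by apply: cvgB; [exact: cvg_id|exact: cvg_cst].
  exact: continuous_max0.
move=> v; apply: cvgM; first exact: cvg_cst.
apply: cvgD; last exact: C.
apply: cvgB; first exact: continuous_max0.
by apply: cvgM; [exact: cvg_cst|exact: C].
Qed.

Lemma smooth_step0 v : v <= 0 -> smooth_step v = 0.
Proof. by move=> v0; rewrite /smooth_step !max_r; lra. Qed.

Lemma smooth_step1 v : 1 <= v -> smooth_step v = 1.
Proof. by move=> v0; rewrite /smooth_step !max_l; [field|lra..]. Qed.

Lemma tent0 v : v <= 0 -> tent v = 0.
Proof. by move=> v0; rewrite /tent !max_r; lra. Qed.

Lemma tent1 v : 1 <= v -> tent v = 0.
Proof. by move=> v0; rewrite /tent !max_l; lra. Qed.

Lemma tent_ge0_le2 v : 0 <= tent v <= 2.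
Proof. by rewrite /tent; 
have [?|?] := leP v 0; have [?|?] := leP (v - 2^-1) 0;
have [?|?] := leP (v - 1) 0; lra. Qed.

Lemma smooth_step_ge0_le1 v : 0 <= smooth_step v <= 1.
Proof. by rewrite /smooth_step; 
have [?|?] := leP v 0; have [?|?] := leP (v - 2^-1) 0;
have [?|?] := leP (v - 1) 0; nra. Qed.

End SmoothStep.

(** * The Osgood cutoff *)

Lemma near_eq_continuous (T U : topologicalType) (f g : T -> U) (x : T) :
  (\near x, f x = g x) -> {for x, continuous f} -> {for x, continuous g}.
Proof.
move=> fg fx; have gfx := nbhs_singleton fg.
rewrite /continuous_at /prop_for -gfx.
by apply: (cvg_trans _ fx); apply: near_eq_cvg.
Qed.

(* [h] is a smooth step in the variable [ln (ln (1/s))]. *)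
Lemma osgood_cutoff (R : realType) (m : R) : 0 < m < 1 ->
  exists h h' : R -> R,
    [/\ forall s : R, is_derive s 1 h (h' s), continuous h',
        forall s, s <= 0 -> h s = 1 /\ h' s = 0,
        forall s, m <= s -> h s = 0 /\ h' s = 0 &
        forall s, 0 <= h s <= 1 /\
          (0 < s < 1 -> `|h' s| * (s * ln (1 / s)) <= 2)].
Proof.
move=> /andP[m0 m1].
(* The constants are chosen so that [u] is 0 at [m] and 1 at [m']; thus [m'] is m^e, and [h] falls
   from 1 to 0 between [m'] and [m]. *)
pose T := ln (- ln m).
pose m' := expR (- expR (T + 1)).
pose u (s : R) := ln (- ln s) - T.
(* [ln] has a default value at nonpositive arguments, so the formula with [u] is meaningful only for
   0 < s < 1; elsewhere the constants are imposed. *)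
pose h s : R := if s <= 0 then 1 else if 1 <= s then 0 else smooth_step (u s).
pose h' s : R := if s <= 0 then 0 else if 1 <= s then 0 else
  tent (u s) * ((- ln s)^-1 * - s^-1).
have lnm : 0 < - ln m by rewrite oppr_gt0 ln_lt0// m0.
have h_small s : s <= m' -> h s = 1 /\ h' s = 0.
  move=> sm'; rewrite /h /h'; case: leP => // s0.
  have sm1 : s < 1.
    by rewrite (le_lt_trans sm')// -expR0 ltr_expR oppr_lt0 expR_gt0.
  rewrite leNgt sm1 /=.
  have u1 : 1 <= u s.
    rewrite /u lerBrDr addrC -[T + 1]expRK ler_ln ?posrE ?expR_gt0//; last first.
      by rewrite oppr_gt0 ln_lt0// s0.
    by rewrite lerNr -[leRHS]expRK ler_ln ?posrE ?expR_gt0.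
  by rewrite smooth_step1// tent1// mul0r.
have h_large s : m <= s -> h s = 0 /\ h' s = 0.
  move=> ms; have s0 : 0 < s by exact: lt_le_trans ms.
  rewrite /h /h' leNgt s0 /=; case: leP => // s1.
  have u0 : u s <= 0.
    rewrite /u subr_le0 ler_ln ?posrE//; last by rewrite oppr_gt0 ln_lt0// s0.
    by rewrite lerN2 ler_ln ?posrE.
  by rewrite smooth_step0// tent0// mul0r.
have mid (s : R) : 0 < s < 1 -> is_derive s 1 (fun s : R => smooth_step (u s))
    (tent (u s) * ((- ln s)^-1 * - s^-1)).
  move=> /andP[s0 s1].
  have lns : 0 < - ln s by rewrite oppr_gt0 ln_lt0// s0.
  have d1 : is_derive s 1 (fun s : R => - ln s) (- s^-1).
    by apply: is_deriveN; exact: is_derive1_ln.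
  have d2 : is_derive s 1 (fun s : R => ln (- ln s)) ((- ln s)^-1 * - s^-1).
    apply: (@is_derive1_comp _ (@ln R) (fun s : R => - ln s)).
    exact: is_derive1_ln.
  have d3 : is_derive s 1 u ((- ln s)^-1 * - s^-1).
    rewrite (_ : u = (fun s : R => ln (- ln s)) - cst T)//.
    by apply: is_derive_eq; rewrite subr0.
  apply: (@is_derive1_comp _ (@smooth_step R) u).
  exact: is_derive_smooth_step.
have m'0 : 0 < m' by exact: expR_gt0.
exists h, h'; split => [s|s|s s0|//|s].
(* The open sets s < m', 0 < s < 1 and m < s cover the line; on them [h] is 1, the composite
   [smooth_step (u s)] and 0 respectively. *)
- have [sm'|m's] := ltP s m'.
    apply: (@near_eq_is_derive R R^o R^o (cst 1)).
      near=> t => /=; have [|-> //] := h_small t.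
      by apply: ltW; near: t; exact: lt_nbhsl.
    by rewrite (h_small _ (ltW sm')).2; exact: is_derive_cst.
  have s0 : 0 < s by exact: lt_le_trans m's.
  have [s1|s1] := ltP s 1; last first.
    apply: (@near_eq_is_derive R R^o R^o (cst 0)).
      near=> t => /=; have [|-> //] := h_large t.
      by apply: ltW; near: t; apply: lt_nbhsr; exact: lt_le_trans s1.
    rewrite (h_large _ _).2; first exact: is_derive_cst.
    by apply: ltW; exact: lt_le_trans s1.
  rewrite /h' (leNgt s) s0 leNgt s1 /=.
  apply: (@near_eq_is_derive R R^o R^o (fun s : R => smooth_step (u s))).
    near=> t; rewrite /h leNgt (_ : 0 < t); last first.
      by near: t; exact: lt_nbhsr.
    by rewrite leNgt (_ : t < 1)//; near: t; exact: lt_nbhsl.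
  by apply: mid; rewrite s0.
- have [sm'|m's] := ltP s m'.
    apply: (@near_eq_continuous R R (cst 0)).
      near=> t => /=; have [|_ -> //] := h_small t.
      by apply: ltW; near: t; exact: lt_nbhsl.
    exact: cvg_cst.
  have s0 : 0 < s by exact: lt_le_trans m's.
  have [s1|s1] := ltP s 1; last first.
    apply: (@near_eq_continuous R R (cst 0)).
      near=> t => /=; have [|_ -> //] := h_large t.
      by apply: ltW; near: t; apply: lt_nbhsr; exact: lt_le_trans s1.
    exact: cvg_cst.
  have lns : 0 < - ln s by rewrite oppr_gt0 ln_lt0// s0.
  apply: (@near_eq_continuous R R
    (fun s : R => tent (u s) * ((- ln s)^-1 * - s^-1))).
    near=> t; rewrite /h' leNgt (_ : 0 < t); last first.
      by near: t; exact: lt_nbhsr.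
    by rewrite leNgt (_ : t < 1)//; near: t; exact: lt_nbhsl.
  have cl : (fun s : R => - ln s) @ s --> - ln s.
    by apply: cvgN; exact: continuous_ln.
  apply: cvgM.
    apply: (@continuous_comp R R R u (@tent R)); last exact: continuous_tent.
    apply: cvgB; last exact: cvg_cst.
    apply: (@continuous_comp R R R (fun s : R => - ln s) (@ln R)) => //.
    exact: continuous_ln.
  apply: cvgM; first by apply: cvgV => //; rewrite gt_eqF.
  by apply: cvgN; apply: cvgV; [rewrite gt_eqF|exact: cvg_id].
- by apply: h_small; apply: ltW; exact: le_lt_trans s0 _.
split.
  rewrite /h; case: ifPn => _; first by rewrite ler01 lexx.
  case: ifPn => _; first by rewrite ler01 lexx.
  exact: smooth_step_ge0_le1.
move=> /andP[s0 s1].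
have lns : 0 < - ln s by rewrite oppr_gt0 ln_lt0// s0.
rewrite /h' (leNgt s) s0 (leNgt 1) s1 /= div1r lnV ?posrE//.
have /andP[t0 t2] := tent_ge0_le2 (u s).
rewrite normrM (ger0_norm t0) mulrN normrN ger0_norm; last first.
  by rewrite mulr_ge0// invr_ge0 ltW.
(* The weight s ln (1/s) cancels |u'| exactly, so the bound does not depend on [m]. *)
have -> : tent (u s) * ((- ln s)^-1 / s) * (s * - ln s) = tent (u s).
  have lns0 : ln s != 0 by rewrite lt_eqF// -oppr_gt0.
  by field; rewrite lns0 gt_eqF.
exact: t2.
Unshelve. all: by end_near.
Qed.

(** * Mean value estimate and continuity of C^1 functions of the plane *)

Lemma mean_value_le (R : realType) (f df : R -> R) (a b M : R) :
  (forall c : R, is_derive c 1 f (df c)) ->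
  (forall c, `|c - a| <= `|b - a| -> `|df c| <= M) ->
  `|f b - f a| <= M * `|b - a|.
Proof.
move=> fdf dfM.
have fcont (x y : R) : {within `[x, y], continuous f}.
  by apply: derivable_within_continuous => c _; exact: ex_derive.
have [ab|ba] := leP a b.
  have [//|c] := MVT_segment ab (fun c _ => fdf c).
  rewrite in_itv /= => /andP[ac cb] ->.
  rewrite normrM ler_wpM2r// dfM// !ger0_norm; lra.
have [//|c] := MVT_segment (ltW ba) (fun c _ => fdf c).
rewrite in_itv /= => /andP[ac cb] Ec.
rewrite distrC Ec normrM (distrC b) ler_wpM2r// dfM//.
rewrite [leLHS]ler0_norm ?ler0_norm; lra.
Qed.

Lemma derivable1_is_derive (R : realType) (f : R -> R) (x : R) :
  derivable f x 1 -> is_derive x 1 f (derive1 f x).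
Proof. by move=> fx; apply: DeriveDef => //; rewrite derive1E. Qed.

(** Near the point the x-derivative is bounded by some M, so horizontal moves are Lipschitz
    uniformly in y; the remaining vertical move takes place on the fixed line x = x0. *)
Lemma C1_plane_continuous (R : realType) (g : R * R -> R) :
  C1_plane g -> continuous g.
Proof.
move=> [gx gy cx _] [x0 y0]; apply/cvgrPdist_lt => e e0.
pose M := `|partial_x g (x0, y0)| + 1.
have M0 : 0 < M by rewrite ltr_wpDl.
have [r /= r0 Hr] : exists2 r : R, 0 < r & forall x y : R,
    `|x - x0| < r -> `|y - y0| < r -> `|partial_x g (x, y)| <= M.
  have /cvgrPdist_lt /(_ 1 ltr01) := cx (x0, y0).
  move=> /nbhs_ballP[r /= r0 Hr]; exists r => // x y xr yr.
  rewrite distrC in xr; rewrite distrC in yr.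
  have /ltW := Hr (x, y) (conj xr yr); rewrite distrC.
  by move=> /(le_trans (lerB_dist _ _)); rewrite /M; lra.
have cy : \forall q \near (x0, y0), `|g (x0, y0) - g (x0, q.2)| < e / 2.
  have /cvgrPdist_lt /(_ (e / 2)) : (fun t => g (x0, t)) @ y0 --> g (x0, y0).
    exact/differentiable_continuous/derivable1_diffP.
  by rewrite divr_gt0// => /(_ isT); exact: (@cvg_snd _ _ (nbhs x0) (nbhs y0)).
have near_ball (c d : R) : 0 < d -> \forall t \near c, `|t - c| < d.
  move=> d0; apply: filterS (nbhsx_ballx c d d0) => t.
  by rewrite /ball /= distrC.
(* Within [r] the bound [M] is valid; within e / (2 M) the horizontal move costs less than e / 2. *)
have near1 : \forall q \near (x0, y0), `|q.1 - x0| < Num.min r (e / 2 / M).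
  have : \forall t \near x0, `|t - x0| < Num.min r (e / 2 / M).
    by apply: near_ball; rewrite lt_min r0 !divr_gt0.
  exact: (@cvg_fst _ _ (nbhs x0) (nbhs y0)).
have near2 : \forall q \near (x0, y0), `|q.2 - y0| < r.
  have := near_ball y0 r r0.
  exact: (@cvg_snd _ _ (nbhs x0) (nbhs y0)).
near=> q.
have /andP[q1 q1'] : (`|q.1 - x0| < r) && (`|q.1 - x0| < e / 2 / M).
  by rewrite -lt_min; near: q.
have q2 : `|q.2 - y0| < r by near: q.
have ineq2 : `|g (x0, y0) - g (x0, q.2)| < e / 2 by near: q.
have : `|g (q.1, q.2) - g (x0, q.2)| <= M * `|q.1 - x0|.
  apply: (@mean_value_le _ (fun t => g (t, q.2))
    (fun t => partial_x g (t, q.2))).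
    by move=> c; apply: derivable1_is_derive.
  by move=> c cx0; apply: Hr => //; exact: le_lt_trans q1.
move=> ineq1; have : M * `|q.1 - x0| < e / 2.
  by rewrite mulrC -ltr_pdivlMr//.
move: ineq1 ineq2; rewrite -surjective_pairing.
move: (g q) (g (x0, q.2)) (g (x0, y0)) (M * _) => u v w z.
by rewrite (distrC u); move=> *; rewrite (le_lt_trans (ler_distD v _ _))//; lra.
Unshelve. all: by end_near.
Qed.

(** * Order of the leaves *)

Lemma nonvanishing_gt0 (R : realType) (g : R -> R) (x y : R) :
  continuous g -> (forall t, g t != 0) -> 0 < g x -> 0 < g y.
Proof.
move=> cg g0 gx; rewrite ltNge; apply/negP => gy.
have : exists c, g c = 0.
  have [xy|yx] := leP x y.
    have [||c _ gc] := @IVT R g x y 0 xy; last by exists c.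
      exact: continuous_subspaceT.
    by rewrite ge_min gy orbT le_max ltW.
  have [||c _ gc] := @IVT R g y x 0 (ltW yx); last by exists c.
    exact: continuous_subspaceT.
  by rewrite ge_min gy le_max (ltW gx) orbT.
by move=> [c gc]; have := g0 c; rewrite gc eqxx.
Qed.

Lemma foliation_surj (R : realType) (f : R -> R * R -> R) (p : R * R) (z : R) :
  C1_foliation f -> exists a, f a p = z.
Proof.
move=> [_ _ cover]; have : [set: R * R * R] (p, z) by [].
by rewrite -cover => -[a _ fa]; exists a; exact/esym.
Qed.

Lemma foliation_inj (R : realType) (f : R -> R * R -> R) (p : R * R) (a b : R) :
  C1_foliation f -> f a p = f b p -> a = b.
Proof.
by move=> [_ + _] fab; apply => //; exists (p, f a p).
Qed.

(** Disjoint leaves have a nowhere vanishing height difference, which keeps its sign along a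
    horizontal and then a vertical segment from [p] to [q]. *)
Lemma foliation_lt (R : realType) (f : R -> R * R -> R) (p q : R * R) (a b : R) :
  C1_foliation f -> f a p < f b p -> f a q < f b q.
Proof.
move=> hf fab; have [C1f _ _] := hf.
have neq0 r : f b r - f a r != 0.
  rewrite subr_eq0; apply/eqP => /(foliation_inj hf) ab.
  by move: fab; rewrite ab ltxx.
have cfx c y : continuous (fun t => f c (t, y)).
  by move=> x; have [fx _ _ _] := C1f c; exact/differentiable_continuous/derivable1_diffP.
have cfy c x : continuous (fun t => f c (x, t)).
  by move=> y; have [_ fy _ _] := C1f c; exact/differentiable_continuous/derivable1_diffP.
case: p q fab => [p1 p2] [q1 q2] fab.
have H1 : 0 < f b (q1, p2) - f a (q1, p2).
  apply: (@nonvanishing_gt0 _ (fun t => f b (t, p2) - f a (t, p2)) p1) => //.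
    by move=> t; apply: cvgB; exact: cfx.
  by rewrite subr_gt0.
rewrite -subr_gt0.
apply: (@nonvanishing_gt0 _ (fun t => f b (q1, t) - f a (q1, t)) p2) => //.
by move=> t; apply: cvgB; exact: cfy.
Qed.

(** The given labels carry no order. Here [l c] is the label of the leaf at height [c] over the
    origin, so that the relabelled family increases over every point. *)
Lemma foliation_relabel (R : realType) (f : R -> R * R -> R) :
  C1_foliation f -> exists l : R -> R,
    [/\ forall c d p, c < d -> f (l c) p < f (l d) p &
        forall p z, exists c, f (l c) p = z].
Proof.
move=> hf.
have [l fl] := choice (fun c => foliation_surj (0, 0) c hf).
exists l; split=> [c d p cd|p z].
  by apply: (@foliation_lt _ _ (0, 0)) => //; rewrite !fl.
have [a fa] := foliation_surj p z hf; exists (f a (0, 0)).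
by rewrite (foliation_inj hf (fl (f a (0, 0)))).
Qed.

(** * Finitely many leaves suffice over a compact set *)

Section FiniteLeaves.
Variables (R : realType) (g : R -> R * R -> R).
Hypothesis g_cont : forall c, continuous (g c).
Hypothesis g_lt : forall c d p, c < d -> g c p < g d p.
Hypothesis g_surj : forall p z, exists c, g c p = z.

Let g_le c d p : c <= d -> g c p <= g d p.
Proof. by rewrite le_eqVlt => /predU1P[->//|/(g_lt p)/ltW]. Qed.

Let g_ltP c d p : g c p < g d p -> c < d.
Proof. by rewrite !ltNge; apply: contra; exact: g_le. Qed.

Variable N : R * R * R -> R * R * R -> Prop.
Hypothesis near_N : forall q, \forall q' \near q, N q q'.

(** The centre [q] need not lie over [p]; any two points of the vertical segment are compared
    through it. [N] will express that [phi], [Phi] and [Psi] change little from [q]. *)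
Definition tight (c d : R) (p : R * R) :=
  exists q, forall z, g c p <= z <= g d p -> N q (p, z).

(** Take the leaves at heights z - r/2 and z + r/2 over [p]. Over nearby points they move by less
    than r/4, so they enclose every point whose height is within r/4 of z, and stay within r of
    z. *)
Lemma near_tight (q : R * R * R) : exists c d, \forall q' \near q,
  g c q'.1 < q'.2 < g d q'.1 /\ tight c d q'.1.
Proof.
case: q => p z; have [[A B] /= [pA zB] AB] := near_N (p, z).
have [r /= r0 rB] := (nbhs_ballP _ _).1 zB.
have [c gc] := g_surj p (z - r / 2).
have [d gd] := g_surj p (z + r / 2).
exists c, d.
have near1 (P : R * R -> Prop) : (\forall p' \near p, P p') ->
  \forall q' \near (p, z), P q'.1.
  by move=> h; exact: (@cvg_fst _ _ (nbhs p) (nbhs z)).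
have near2 (P : R -> Prop) : (\forall z' \near z, P z') ->
  \forall q' \near (p, z), P q'.2.
  by move=> h; exact: (@cvg_snd _ _ (nbhs p) (nbhs z)).
have r40 : 0 < r / 4 by rewrite divr_gt0.
have nc : \forall q' \near (p, z), `|g c p - g c q'.1| < r / 4.
  by apply: (near1 (fun p' => `|g c p - g c p'| < _));
  move/cvgrPdist_lt : (@g_cont c p); exact.
have nd : \forall q' \near (p, z), `|g d p - g d q'.1| < r / 4.
  by apply: (near1 (fun p' => `|g d p - g d p'| < _));
  move/cvgrPdist_lt : (@g_cont d p); exact.
have nz : \forall q' \near (p, z), `|z - q'.2| < r / 4.
  by apply: (near2 (fun z' => `|z - z'| < _)); exact: nbhsx_ballx.
have nA : \forall q' \near (p, z), A q'.1 by exact: near1.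
near=> q'.
have : `|g c p - g c q'.1| < r / 4 by near: q'.
have : `|g d p - g d q'.1| < r / 4 by near: q'.
have : `|z - q'.2| < r / 4 by near: q'.
have Aq' : A q'.1 by near: q'.
rewrite gc gd !ltr_norml => /andP[? ?] /andP[? ?] /andP[? ?].
split; first by apply/andP; split; lra.
exists (p, z) => t /andP[? ?]; apply: AB; split => //=.
by apply: rB; rewrite /ball /= ltr_norml; apply/andP; split; lra.
Unshelve. all: by end_near.
Qed.

Lemma finite_leaves (K : set (R * R * R)) : compact K ->
  exists s : seq R, sorted <%R s /\ forall p z, K (p, z) ->
    exists2 i, (i.+1 < size s)%N &
      g (nth 0 s i) p <= z < g (nth 0 s i.+1) p /\
      tight (nth 0 s i) (nth 0 s i.+1) p.
Proof.
(* Finite lists of labels directed by inclusion: the near-covering form of compactness along this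
   filter gives one list that serves all of [K]. *)
pose F : set_system (seq R) :=
  filter_from setT (fun r : seq R => [set s : seq R | {subset r <= s}]).
have FF : Filter F.
  apply: filter_from_filter; first by exists [::].
  move=> r1 r2 _ _; exists (r1 ++ r2) => // r rr.
  by split=> c cr; apply: rr; rewrite mem_cat cr ?orbT.
pose P (s : seq R) (q : R * R * R) := exists c d, [/\ c \in s, d \in s &
  g c q.1 < q.2 < g d q.1 /\ tight c d q.1].
move=> cK; have : \forall s \near F, K `<=` P s.
  apply: ((compact_near_coveringP K).1 cK) => q _.
  have [c [d cd]] := near_tight q.
  exists ([set q' | g c q'.1 < q'.2 < g d q'.1 /\ tight c d q'.1],
    [set s : seq R | {subset [:: c; d] <= s}]) => /=.
    by split => //; exists [:: c; d].
  move=> [q' s] /= [q'cd cds]; exists c, d; split => //;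
    by apply: cds; rewrite !inE eqxx ?orbT.
move=> [s0 _ /(_ s0 (fun=> id)) KP].
pose s := sort <=%R (undup s0).
have ss : sorted <%R s by rewrite sort_lt_sorted undup_uniq.
exists s; split => // p z /KP[c [d [cs ds [/= /andP[cz zd] T]]]].
rewrite -mem_undup -(mem_sort <=%R) -/s in cs.
rewrite -mem_undup -(mem_sort <=%R) -/s in ds.
(* The upper leaf is the first one in [s] above [z]. It comes after [c], hence has a predecessor,
   and no later than [d]. *)
pose Q x := z < g x p.
have hP : has Q s by apply/hasP; exists d.
have := nth_find 0 hP; set k := find Q s => Pk.
have ks : (k < size s)%N by rewrite -has_find.
have ck : (index c s < k)%N.
  rewrite -(lt_sorted_ltn_nth 0 ss) ?inE ?index_mem// nth_index//.
  by apply: (@g_ltP _ _ p); exact: lt_trans Pk.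
have kd : (k <= index d s)%N.
  rewrite leqNgt; apply/negP => /(before_find 0).
  by rewrite nth_index// /Q zd.
case Ek : k ck ks kd Pk => [//|i] ck ks kd Pk; exists i => //; split.
  apply/andP; split; last exact: Pk.
  rewrite leNgt; apply/negbT/(@before_find _ 0 Q).
  by rewrite -/k Ek.
(* The two consecutive leaves lie between those of [c] and [d], so the same centre serves. *)
have [q Hq] := T; exists q => t /andP[t1 t2]; apply: Hq; apply/andP; split.
  apply: le_trans t1; apply: g_le; rewrite -[leLHS](nth_index 0 cs).
  by rewrite (lt_sorted_leq_nth 0 ss) ?inE ?index_mem// ltnW.
apply: (le_trans t2); apply: g_le; rewrite -[leRHS](nth_index 0 ds).
by rewrite (lt_sorted_leq_nth 0 ss) ?inE ?index_mem.
Qed.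

(** Each of the finitely many gaps is continuous and positive, hence locally above half its value;
    near-covering compactness with [m] tending to 0 from the right makes the bound uniform. *)
Lemma min_gap (s : seq R) (K : set (R * R * R)) : compact K ->
  sorted <%R s -> exists2 m : R, 0 < m < 1 & forall p z, K (p, z) ->
    forall i, (i.+1 < size s)%N ->
      m <= g (nth 0 s i.+1) p - g (nth 0 s i) p.
Proof.
move=> cK ss.
pose P (m : R) (q : R * R * R) := forall i : 'I_(size s), (i.+1 < size s)%N ->
  m <= g (nth 0 s i.+1) q.1 - g (nth 0 s i) q.1.
have H : \forall m \near 0^'+, K `<=` P m.
  apply: ((compact_near_coveringP K).1 cK) => q _.
  apply: (@filter_forall _ _ (fun (i : 'I_(size s)) (x : (R * R * R) * R) =>
    (i.+1 < size s)%N ->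
    x.2 <= g (nth 0 s i.+1) x.1.1 - g (nth 0 s i) x.1.1)
    (filter_prod (nbhs q) 0^'+)) => i.
  have [lti|lti] := ltnP i.+1 (size s); last by apply: nearW => m.
  pose G (q : R * R * R) := g (nth 0 s i.+1) q.1 - g (nth 0 s i) q.1.
  have G0 : 0 < G q / 2.
    rewrite divr_gt0// subr_gt0; apply: g_lt.
    by rewrite (lt_sorted_ltn_nth 0 ss) ?inE// ltnW.
  have cG : G @ q --> G q.
    have lift c : (fun q' : R * R * R => g c q'.1) @ q --> g c q.1.
      apply: (@continuous_comp _ _ _ fst (g c)); first exact: cvg_fst.
      exact: g_cont.
    by apply: cvgB; exact: lift.
  have nG : \forall q' \near q, G q / 2 < G q'.
    move/cvgrPdist_lt : cG => /(_ _ G0); apply: filterS => q'.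
    by rewrite ltr_norml => /andP[_]; lra.
  exists ([set q' | G q / 2 < G q'], [set m | m < G q / 2]) => /=.
    by split => //; exact: nbhs_right_lt.
  by move=> [q' m] /= [q1 q2] _; apply: ltW; exact: lt_trans q1.
have [m [[m0 m1] KP]] : exists m : R, (0 < m /\ m < 1) /\ K `<=` P m.
  apply: (@filter_ex _ (0^'+ : set_system R)).
  apply: filterI => //; apply: filterI; first exact: nbhs_right_gt.
  exact: nbhs_right_lt.
exists m => [|p z /KP + i lti]; first by rewrite m0.
by move=> /(_ (Ordinal (ltnW lti)) lti).
Qed.

End FiniteLeaves.

(** * The interpolating sum and its derivatives *)

Lemma telescope_step (V : comPzRingType) (w v : nat -> V) (n j : nat) :
  (j < n)%N -> (forall i, (i < j)%N -> w i = 1) ->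
  (forall i, (j < i < n)%N -> w i = 0) ->
  v 0 + \sum_(i < n) w i * (v i.+1 - v i) = v j + w j * (v j.+1 - v j).
Proof.
move=> jn w1 w0.
rewrite -(big_mkord xpredT (fun i => w i * (v i.+1 - v i))).
rewrite (big_cat_nat (n := j)) ?(ltnW jn)//= (big_ltn jn).
rewrite (eq_big_nat _ _ (F2 := fun i => v i.+1 - v i)); last first.
  by move=> i /andP[_ /w1->]; rewrite mul1r.
rewrite telescope_sumr// [\sum_(j.+1 <= i < n) _]big_nat_cond big1 ?addr0; last first.
  by move=> i /andP[/w0-> _]; rewrite mul0r.
by rewrite addrA addrCA subrr addr0.
Qed.

Section CutoffDerivative.
Variables (R : realType) (h h' : R -> R).
Hypothesis hh' : forall s : R, is_derive s 1 h (h' s).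

Lemma is_derive_cutoff (u v : R -> R) (t du dv : R) :
  is_derive t 1 u du -> is_derive t 1 v dv ->
  is_derive t 1 (fun t => (1 - h (u t)) * v t)
    (- h' (u t) * du * v t + (1 - h (u t)) * dv).
Proof.
move=> tu tv.
have hu : is_derive t 1 (fun t => h (u t)) (h' (u t) * du).
  exact: (@is_derive1_comp _ h u).
rewrite (_ : (fun t => (1 - h (u t)) * v t)
  = (cst 1 - (fun t => h (u t))) * v)//.
apply: is_derive_eq; rewrite /GRing.scale /= !fctE; ring.
Qed.

(** [F] is the height of the moving point: constant for the x- and y-derivatives in space, the
    identity for the z-derivative, and the height of a leaf for derivatives along it. *)
Lemma is_derive_cutoff_sum (n : nat) (F : R -> R) (G D : nat -> R -> R)
    (dF t : R) (dG dD : nat -> R) :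
  is_derive t 1 F dF -> (forall i, is_derive t 1 (G i) (dG i)) ->
  (forall i, is_derive t 1 (D i) (dD i)) ->
  is_derive t 1
    (fun t => D 0%N t + \sum_(i < n) (1 - h (F t - G i t)) * (D i.+1 t - D i t))
    (dD 0%N + \sum_(i < n) (- h' (F t - G i t) * (dF - dG i) * (D i.+1 t - D i t)
       + (1 - h (F t - G i t)) * (dD i.+1 - dD i))).
Proof.
move=> tF tG tD.
rewrite (_ : (fun t => _) = D 0%N + \sum_(i < n)
  (fun t => (1 - h ((F - G i) t)) * (D i.+1 - D i) t)); last first.
  by apply/funext => s; rewrite !fctE fct_sumE.
apply: is_deriveD; apply: is_derive_sum => i.
by apply: is_derive_cutoff; exact: is_deriveB.
Qed.

End CutoffDerivative.

(** * The interpolating sum is C^1 on space *)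

Section C1Closure.
Variable R : realType.

Lemma C1_spaceI (g gx gy gz : R * R * R -> R) :
  (forall x y z : R, is_derive x 1 (fun t => g (t, y, z)) (gx (x, y, z))) ->
  (forall x y z : R, is_derive y 1 (fun t => g (x, t, z)) (gy (x, y, z))) ->
  (forall x y z : R, is_derive z 1 (fun t => g (x, y, t)) (gz (x, y, z))) ->
  continuous gx -> continuous gy -> continuous gz -> C1_space g.
Proof.
move=> dx dy dz cx cy cz; split.
- by move=> x y z; split; exact: ex_derive.
- rewrite (_ : (fun q => _) = gx)//; apply/funext => -[[x y] z] /=.
  by rewrite derive1E; apply: derive_val.
- rewrite (_ : (fun q => _) = gy)//; apply/funext => -[[x y] z] /=.
  by rewrite derive1E; apply: derive_val.
- rewrite (_ : (fun q => _) = gz)//; apply/funext => -[[x y] z] /=.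
  by rewrite derive1E; apply: derive_val.
Qed.

Lemma C1_plane_is_derive_x (g : R * R -> R) (x y : R) :
  C1_plane g -> is_derive x 1 (fun t => g (t, y)) (partial_x g (x, y)).
Proof. by move=> [gx _ _ _]; exact: derivable1_is_derive. Qed.

Lemma C1_plane_is_derive_y (g : R * R -> R) (x y : R) :
  C1_plane g -> is_derive y 1 (fun t => g (x, t)) (partial_y g (x, y)).
Proof. by move=> [_ gy _ _]; exact: derivable1_is_derive. Qed.

Lemma C1_space_cutoff_sum (h h' : R -> R) (n : nat) (G D : nat -> R * R -> R) :
  (forall s : R, is_derive s 1 h (h' s)) -> continuous h' ->
  (forall i, C1_plane (G i)) -> (forall i, C1_plane (D i)) ->
  C1_space (fun q => D 0%N q.1 +
    \sum_(i < n) (1 - h (q.2 - G i q.1)) * (D i.+1 q.1 - D i q.1)).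
Proof.
move=> hh' ch' C1G C1D.
(* One formula for all three partial derivatives: [dF] is 0 in the horizontal directions; in the
   vertical one it is 1, with [dG] and [dD] zero. *)
pose dval (dF : R) (dG dD : nat -> R * R -> R) (q : R * R * R) :=
  dD 0%N q.1 + \sum_(i < n)
    (- h' (q.2 - G i q.1) * (dF - dG i q.1) * (D i.+1 q.1 - D i q.1)
       + (1 - h (q.2 - G i q.1)) * (dD i.+1 q.1 - dD i q.1)).
have lift (E : R * R -> R) : continuous E -> continuous (fun q : R * R * R => E q.1).
  by move=> cE q; apply: (@continuous_comp _ _ _ fst E); [exact: cvg_fst|exact: cE].
have cdval dF dG dD : (forall i, continuous (dG i)) ->
    (forall i, continuous (dD i)) -> continuous (dval dF dG dD).
  move=> cG cD q; apply: cvgD; first exact: lift.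
  pose S (i : 'I_n) (q : R * R * R) : R :=
    - h' (q.2 - G i q.1) * (dF - dG i q.1) * (D i.+1 q.1 - D i q.1)
       + (1 - h (q.2 - G i q.1)) * (dD i.+1 q.1 - dD i q.1).
  suff cS : continuous (fun q => \sum_(i < n) S i q) by exact: cS.
  apply: continuous_big => [|i _ {}q]; first exact: add_continuous.
  have cu : (fun q => q.2 - G i q.1) @ q --> q.2 - G i q.1.
    apply: cvgB; first exact: cvg_snd.
    exact: (lift _ (C1_plane_continuous (C1G i))).
  apply: cvgD; apply: cvgM.
  - apply: cvgM.
      apply: cvgN.
      apply: (@continuous_comp _ _ _ (fun q => q.2 - G i q.1) h');
        by [exact: cu|exact: ch'].
    by apply: cvgB; [exact: cvg_cst|exact: lift].
  - by apply: cvgB; apply: lift; apply: C1_plane_continuous.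
  - apply: cvgB; first exact: cvg_cst.
    apply: (@continuous_comp _ _ _ (fun q => q.2 - G i q.1) h); first exact: cu.
    exact: (@is_derive1_continuous _ _ h').
  - by apply: cvgB; apply: lift.
refine (@C1_spaceI _ (dval 0 (fun i => partial_x (G i)) (fun i => partial_x (D i)))
  (dval 0 (fun i => partial_y (G i)) (fun i => partial_y (D i)))
  (dval 1 (fun=> cst 0) (fun=> cst 0)) _ _ _ _ _ _).
- move=> x y z.
  apply: (@is_derive_cutoff_sum _ h h' hh' n (cst z) (fun i t => G i (t, y))
    (fun i t => D i (t, y)) 0 x (fun i => partial_x (G i) (x, y))
    (fun i => partial_x (D i) (x, y))) => i;
    exact: C1_plane_is_derive_x.
- move=> x y z.
  apply: (@is_derive_cutoff_sum _ h h' hh' n (cst z) (fun i t => G i (x, t))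
    (fun i t => D i (x, t)) 0 y (fun i => partial_y (G i) (x, y))
    (fun i => partial_y (D i) (x, y))) => i;
    exact: C1_plane_is_derive_y.
- move=> x y z.
  exact: (@is_derive_cutoff_sum _ h h' hh' n id (fun i t => G i (x, y))
    (fun i t => D i (x, y)) 1 z (fun=> 0) (fun=> 0)).
- by apply: cdval => i; [have [] := C1G i|have [] := C1D i].
- by apply: cdval => i; [have [] := C1G i|have [] := C1D i].
- by apply: cdval => i q; exact: cvg_cst.
Qed.

End C1Closure.

(** * Estimates over a fixed point of the plane *)

Lemma convex_dist_lt (R : realDomainType) (a b c w r : R) : 0 <= w <= 1 ->
  `|a - c| < r -> `|b - c| < r -> `|a + w * (b - a) - c| < r.
Proof.
move=> /andP[w0 w1] ac bc.
have : `|a + w * (b - a) - c| <= Num.max `|a - c| `|b - c|.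
  have := le_max `|a - c| `|a - c| `|b - c|.
  have := le_max `|b - c| `|a - c| `|b - c|.
  rewrite !lexx orbT /= !ler_norml => /andP[? ?] /andP[? ?].
  by apply/andP; split; nra.
by move=> /le_lt_trans; apply; rewrite gt_max ac.
Qed.

Section CutoffEstimate.
Variables (R : realType) (h h' : R -> R) (m : R).
Hypothesis m01 : 0 < m < 1.
Hypothesis h_le0 : forall s, s <= 0 -> h s = 1 /\ h' s = 0.
Hypothesis h_gem : forall s, m <= s -> h s = 0 /\ h' s = 0.
Hypothesis h_bound : forall s, 0 <= h s <= 1 /\
  (0 < s < 1 -> `|h' s| * (s * ln (1 / s)) <= 2).

Variables (n j : nat) (G : nat -> R) (F : R).
Hypothesis jn : (j < n)%N.
Hypothesis GF : G j <= F < G j.+1.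
Hypothesis G_le : forall i k, (i <= k <= n)%N -> G i <= G k.
Hypothesis G_gap : forall i, (i < n)%N -> m <= G i.+1 - G i.

Let below i : (i < j)%N -> h (F - G i) = 0 /\ h' (F - G i) = 0.
Proof.
move=> ij; apply: h_gem; have /andP[jF _] := GF.
apply: (le_trans (G_gap (ltn_trans ij jn))); rewrite lerB//.
by apply: le_trans jF; apply: G_le; rewrite ij ltnW.
Qed.

Let above i : (j < i < n)%N -> h (F - G i) = 1 /\ h' (F - G i) = 0.
Proof.
move=> /andP[ji ni]; apply: h_le0; have /andP[_ /ltW Fj] := GF.
by rewrite subr_le0 (le_trans Fj)// G_le// ji ltnW.
Qed.

(** For i < j the height [F] is at least a full gap above [G i], giving weight 1; for i > j it is
    below [G i], giving weight 0. The sum telescopes to a single interpolation. *)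
Lemma cutoff_sum_eq (v : nat -> R) :
  v 0%N + \sum_(i < n) (1 - h (F - G i)) * (v i.+1 - v i) =
  v j + (1 - h (F - G j)) * (v j.+1 - v j).
Proof.
apply: (@telescope_step R (fun i => 1 - h (F - G i))) => // i ij.
  by rewrite (below ij).1 subr0.
by rewrite (above ij).1 subrr.
Qed.

Let weight01 : 0 <= 1 - h (F - G j) <= 1.
Proof. by have [/andP[? ?] _] := h_bound (F - G j); apply/andP; split; lra. Qed.

Lemma cutoff_sum_dist_lt (v : nat -> R) (c r : R) :
  `|v j - c| < r -> `|v j.+1 - c| < r ->
  `|v 0%N + \sum_(i < n) (1 - h (F - G i)) * (v i.+1 - v i) - c| < r.
Proof. by rewrite cutoff_sum_eq; exact: convex_dist_lt. Qed.

Lemma cutoff_sum_derive_dist_lt (D dD dG : nat -> R) (dF L c r : R) :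
  (`|F - G j| < 1 ->
     `|dF - dG j| <= L * `|F - G j| * ln (1 / `|F - G j|)) ->
  `|D j.+1 - D j| <= r ->
  `|dD j - c| < r -> `|dD j.+1 - c| < r ->
  `|dD 0%N + \sum_(i < n) (- h' (F - G i) * (dF - dG i) * (D i.+1 - D i)
       + (1 - h (F - G i)) * (dD i.+1 - dD i)) - c| < r + 2 * `|L| * r.
Proof.
move=> logL Dr d1 d2.
(* Separate the convex combination of the [dD] from the error terms in [h']; of the latter only the
   [j]-th survives. *)
rewrite big_split /= addrCA (bigD1 (Ordinal jn))//= big1 ?addr0; last first.
  move=> i /eqP/val_eqP/=; rewrite neq_ltn => /orP[ij|ji].
    by rewrite (below ij).2 oppr0 !mul0r.
  by rewrite (above (introT andP (conj ji (ltn_ord i)))).2 oppr0 !mul0r.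
rewrite -addrA addrC; apply: (le_lt_trans (ler_normD _ _)).
apply: ltr_leD; first exact: cutoff_sum_dist_lt.
rewrite normrM ler_pM// normrM normrN.
have r0 : 0 < r by exact: le_lt_trans d1.
(* [h'] vanishes unless 0 < F - G j < m, and there m < 1 makes the logarithmic bound available. *)
have [s0|s0] := leP (F - G j) 0.
  by rewrite (h_le0 s0).2 normr0 mul0r mulr_ge0.
have [ms|sm] := leP m (F - G j).
  by rewrite (h_gem ms).2 normr0 mul0r mulr_ge0.
have s1 : F - G j < 1 by apply: (lt_trans sm); case/andP: m01.
move: logL; rewrite (gtr0_norm s0) => /(_ s1) logL.
have [_] := h_bound (F - G j); rewrite s0 s1 => /(_ isT) hs.
set s := F - G j in hs logL s0 s1 *.
have ln0 : 0 <= s * ln (1 / s).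
  by rewrite mulr_ge0 ?(ltW s0)// ln_ge0// div1r invf_ge1// ltW.
(* [L] may be negative; since s ln (1/s) >= 0 it can be replaced by its absolute value. *)
have {}logL : `|dF - dG j| <= `|L| * (s * ln (1 / s)).
  by apply: (le_trans logL); rewrite -mulrA ler_wpM2r// ler_norm.
apply: (le_trans (ler_wpM2l (normr_ge0 _) logL)).
by rewrite mulrCA (mulrC 2) ler_wpM2l.
Qed.

End CutoffEstimate.

(** * Approximation on the compact set *)

Theorem theorem2 (R : realType) (f : R -> R * R -> R)
    (hf : C1_foliation f)
    (phi : R * R * R -> R) (hphi : partially_C1 f phi)
    (K : set (R * R * R)) (hK : compact K)
    (eps : R) (heps : 0 < eps)
    (L : R)
    (hLx : log_lipschitz f (fun a : R => partial_x (f a)) L)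
    (hLy : log_lipschitz f (fun a : R => partial_y (f a)) L) :
  exists psi : R * R * R -> R,
    C1_space psi /\
    forall (a x y : R), K (x, y, f a (x, y)) ->
      [/\ `|psi (x, y, f a (x, y)) - phi (x, y, f a (x, y))| < eps,
          `|partial_x (on_surface (f a) psi) (x, y)
            - partial_x (on_surface (f a) phi) (x, y)| < eps &
          `|partial_y (on_surface (f a) psi) (x, y)
            - partial_y (on_surface (f a) phi) (x, y)| < eps].
Proof.
have [C1f _ _] := hf.
have [cphi C1phi [Phi [cPhi PhiE]] [Psi [cPsi PsiE]]] := hphi.
have [l [g_lt g_surj]] := foliation_relabel hf.
have g_cont c : continuous (f (l c)) by exact: C1_plane_continuous.
have L0 : 0 < 2 + 4 * `|L| by rewrite ltr_wpDr// mulr_ge0.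
(* Two points within [e] of a common centre differ by less than r = 2 e, and the derivative estimate
   r + 2 |L| r is then exactly [eps]. *)
pose e := eps / (2 + 4 * `|L|).
have e0 : 0 < e by rewrite divr_gt0.
have epsE : 2 * e + 2 * `|L| * (2 * e) = eps by rewrite /e; field; rewrite gt_eqF.
have le_eps : 2 * e <= eps by rewrite -epsE lerDl !mulr_ge0// ltW.
pose N (q q' : R * R * R) := [/\ `|phi q' - phi q| < e,
  `|Phi q' - Phi q| < e & `|Psi q' - Psi q| < e].
have near_N q : \forall q' \near q, N q q'.
  have near_e (F : R * R * R -> R) : continuous F ->
      \forall q' \near q, `|F q' - F q| < e.
    move=> /(_ q)/cvgrPdist_lt/(_ e e0); apply: filterS => q'.
    by rewrite distrC.
  near=> q'; split; by [near: q'; exact: near_e].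
have N_dist (F : R * R * R -> R) q q' q'' : `|F q' - F q| < e ->
    `|F q'' - F q| < e -> `|F q' - F q''| < 2 * e.
  by rewrite !ltr_norml => /andP[? ?] /andP[? ?]; apply/andP; split; lra.
have [s [ss sK]] := @finite_leaves _ (fun c => f (l c)) g_cont g_lt g_surj N
  near_N K hK.
have [m m01 gap] := @min_gap _ (fun c => f (l c)) g_cont g_lt s K hK ss.
have [h [h' [hh' ch' h_le0 h_gem h_bound]]] := osgood_cutoff m01.
(* The number of gaps. If [s] has fewer than two entries then [K] is empty, and the default label in
   [nth] is harmless. *)
pose n := (size s).-1.
pose G i := f (l (nth 0 s i)).
pose D i := on_surface (G i) phi.
have C1G i : C1_plane (G i) by exact: C1f.
have C1D i : C1_plane (D i) by exact: C1phi.
(* Written as one sum, the function is C^1 on all of space, even where gaps away from [K] are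
   narrower than [m] and several terms vary at once. *)
exists (fun q => D 0%N q.1 +
  \sum_(i < n) (1 - h (q.2 - G i q.1)) * (D i.+1 q.1 - D i q.1)).
split; first exact: C1_space_cutoff_sum ch' C1G C1D.
move=> a x y Kxy.
have [j js [GF [q Nq]]] := sK _ _ Kxy.
have jn : (j < n)%N by rewrite /n; case: (size s) js.
have Gj : G j (x, y) <= G j.+1 (x, y).
  by case/andP: GF => jF /ltW; exact: le_trans.
(* The point and its vertical projections to the two enclosing leaves share the centre [q]. *)
have N0 : N q (x, y, f a (x, y)).
  by apply: Nq; case/andP: GF => -> /ltW.
have Nj : N q (x, y, G j (x, y)) by apply: Nq; rewrite lexx.
have Nj1 : N q (x, y, G j.+1 (x, y)) by apply: Nq; rewrite lexx andbT.
have G_le i k : (i <= k <= n)%N -> G i (x, y) <= G k (x, y).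
  move=> /andP[]; rewrite leq_eqVlt => /predU1P[->//|ik] kn.
  have ks : (k < size s)%N by move: kn jn; rewrite /n; case: (size s).
  apply/ltW/g_lt; rewrite (lt_sorted_ltn_nth 0 ss)// ?inE//.
  exact: ltn_trans ks.
have G_gap i : (i < n)%N -> m <= G i.+1 (x, y) - G i (x, y).
  move=> i_n; apply: gap Kxy _ _.
  by move: i_n; rewrite /n; case: (size s).
have [phi0 Phi0 Psi0] := N0.
have [phij Phij Psij] := Nj.
have [phij1 Phij1 Psij1] := Nj1.
split.
- apply: lt_le_trans le_eps.
  apply: (cutoff_sum_dist_lt h_le0 h_gem h_bound (G := fun i => G i (x, y))
    jn GF G_le G_gap (v := fun i => D i (x, y))).
    exact: N_dist phij phi0.
  exact: N_dist phij1 phi0.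
(* Each x-derivative of [phi] along a leaf is a value of [Phi], so the convex part is controlled by
   the oscillation of [Phi] and the error term by that of [phi]. *)
- rewrite -PhiE -epsE {1}/partial_x /on_surface /= derive1E.
  have := @is_derive_cutoff_sum _ h h' hh' n (fun t => f a (t, y))
    (fun i t => G i (t, y)) (fun i t => D i (t, y)) _ x _ _
    (C1_plane_is_derive_x x y (C1f a))
    (fun i => C1_plane_is_derive_x x y (C1G i))
    (fun i => C1_plane_is_derive_x x y (C1D i)).
  move=> [_ ->].
  apply: (cutoff_sum_derive_dist_lt m01 h_le0 h_gem h_bound
    (G := fun i => G i (x, y)) jn GF G_le G_gap
    (D := fun i => D i (x, y)) (dD := fun i => partial_x (D i) (x, y))
    (dG := fun i => partial_x (G i) (x, y))
    (hLx (l (nth 0 s j)) a (x, y))).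
  + by apply: ltW; exact: N_dist phij1 phij.
  + by rewrite -PhiE; exact: N_dist Phij Phi0.
  + by rewrite -PhiE; exact: N_dist Phij1 Phi0.
- rewrite -PsiE -epsE {1}/partial_y /on_surface /= derive1E.
  have := @is_derive_cutoff_sum _ h h' hh' n (fun t => f a (x, t))
    (fun i t => G i (x, t)) (fun i t => D i (x, t)) _ y _ _
    (C1_plane_is_derive_y x y (C1f a))
    (fun i => C1_plane_is_derive_y x y (C1G i))
    (fun i => C1_plane_is_derive_y x y (C1D i)).
  move=> [_ ->].
  apply: (cutoff_sum_derive_dist_lt m01 h_le0 h_gem h_bound
    (G := fun i => G i (x, y)) jn GF G_le G_gap
    (D := fun i => D i (x, y)) (dD := fun i => partial_y (D i) (x, y))
    (dG := fun i => partial_y (G i) (x, y))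
    (hLy (l (nth 0 s j)) a (x, y))).
  + by apply: ltW; exact: N_dist phij1 phij.
  + by rewrite -PsiE; exact: N_dist Psij Psi0.
  + by rewrite -PsiE; exact: N_dist Psij1 Psi0.
Unshelve. all: by end_near.
Qed.
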